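(* (Joint model.) Let $n\ge1$ and consider pipes $P_1,\dots,P_n$ merging into one pipe $P_0$. Let $p_{j,r},q_{j,\ell},p_{j,\ell},q_{j,r}$ ($j=0,\dots,n$) be real-valued functions of time, with $p_{j,r},q_{j,\ell}$ differentiable, satisfying $$\dot p_{j,r}=\alpha_j(q_{j,r}-q_{j,\ell}),\qquad \dot q_{j,\ell}=\beta_j p_{j,r}+\kappa_j p_{j,\ell}+\gamma_j q_{j,\ell},\qquad j=0,\dots,n,$$ and the matching conditions $$p_{1,r}=\dots=p_{n,r}=p_{0,\ell},\qquad q_{1,r}+\dots+q_{n,r}=q_{0,\ell}.$$ Put $$u=\begin{bmatrix}p_{1,\ell}&\dots&p_{n,\ell}&q_{0,r}\end{bmatrix}^\top\in\mathbb R^{n+1},\quad x=\begin{bmatrix}p_{0,r}&p_{1,r}&q_{0,\ell}&q_{1,\ell}&\dots&q_{n,\ell}\end{bmatrix}^\top\in\mathbb R^{n+3},\quad y=\begin{bmatrix}p_{0,r}&q_{1,\ell}&\dots&q_{n,\ell}\end{bmatrix}^\top\in\mathbb R^{n+1}.$$ Then $$\dot x=\begin{bmatrix}\mathbf 0_{2,2}& A_{12} \\ {A_{21}}& A_{22}\end{bmatrix}x+\begin{bmatrix} B_1 \\ {B_2}\end{bmatrix}u,\qquad y=\begin{bmatrix}\begin{matrix}1&0&0&0\\ 0&0&0&1\end{matrix}&\mathbf 0_{2,n-1}\\ \mathbf 0_{n-1,4}&I_{n-1}\end{bmatrix}x,$$ where $$A_{12}=\begin{bmatrix}-\alpha_0&\mathbf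 0_n\\ a&-a\mathbf 1_n\end{bmatrix},\quad A_{21}=\begin{bmatrix}\beta_0&0&0&\dots&0\\ \kappa_0&\beta_1&\beta_2&\dots&\beta_n\end{bmatrix}^\top,\quad A_{22}=\operatorname{diag}(\gamma_0,\dots,\gamma_n),$$ $$B_1=\begin{bmatrix}\mathbf 0_n&\alpha_0\\ \mathbf 0_n&0\end{bmatrix},\quad B_2=\begin{bmatrix}\mathbf 0_{n+1}\\ \begin{matrix}\operatorname{diag}(\kappa_1,\dots,\kappa_n)&\mathbf 0_n^\top\end{matrix}\end{bmatrix},\quad a=\alpha_1\left(\sum_{j=1}^n\prod_{\substack{i=1\\ i\ne j}}^n\alpha_i\right)^{-1}\prod_{i=2}^n\alpha_i.$$
   Context: For pipe $P_j$, $p_{j,\ell},p_{j,r}$ are the (deviations of) pressures at the left and right ends, and $q_{j,\ell},q_{j,r}$ the (deviations of) mass flows at the left and right ends. $\alpha_j,\beta_j,\kappa_j,\gamma_j$ are real constants with $\alpha_j=-\frac{R_sT_0z_0}{A_jX_j}<0$ and $\beta_j=-\frac{A_j}{X_j}<0$, where $R_s,T_0,z_0,A_j,X_j>0$ (specific gas constant, temperature, compressibility factor, cross-sectional area, length). $\mathbf 0_k$ and $\mathbf 1_k$ denote the row vectors of zeros and ones of length $k$; $\mathbf 0_{k,l}$ is the $k\times l$ zero matrix; $I_k$ is the identity. Empty products equal $1$, and blocks with zero rows or columns are absent. *)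

(* Defs.v *)
From HB Require Import structures.
From mathcomp Require Import all_boot all_order all_algebra.
From mathcomp Require Import all_classical all_reals all_analysis.
Set Implicit Arguments.
Unset Strict Implicit.
Unset Printing Implicit Defensive.
Import Order.TTheory GRing.Theory Num.Theory.
Import numFieldNormedType.Exports.
Local Open Scope ring_scope.

(* Pipe data are families indexed by nat; only the indices 0, ..., n matter.
   A scalar c is embedded as the 1 x 1 block c%:M, and the dimensions n + 3,
   2 and n + 1 are written 1 + 1 + (1 + n), 1 + 1 and 1 + n (n + 1 for the
   input, whose scalar entry comes last) so as to match the blocks. *)
Section JointModel.
Variable R : realType.

Section Matrices.
Variables (n : nat) (alpha beta kappa gamma : nat -> R).

Definition joint_a : R :=
  alpha 1%N
  * (\sum_(1 <= j < n.+1) \prod_(1 <= i < n.+1 | i != j) alpha i)^-1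
  * \prod_(2 <= i < n.+1) alpha i.

Definition joint_A12 : 'M[R]_(1 + 1, 1 + n) :=
  block_mx (- alpha 0%N)%:M 0
           joint_a%:M       (- joint_a *: const_mx 1).

Definition joint_A21 : 'M[R]_(1 + n, 1 + 1) :=
  (block_mx (beta 0%N)%:M  0
            (kappa 0%N)%:M (\row_(j < n) beta j.+1))^T.

Definition joint_A22 : 'M[R]_(1 + n) := diag_mx (\row_(j < 1 + n) gamma j).

Definition joint_A : 'M[R]_(1 + 1 + (1 + n)) :=
  block_mx 0 joint_A12 joint_A21 joint_A22.

Definition joint_B1 : 'M[R]_(1 + 1, n + 1) :=
  block_mx 0 (alpha 0%N)%:M
           0 0.

Definition joint_B2 : 'M[R]_(1 + n, n + 1) :=
  col_mx 0 (row_mx (diag_mx (\row_(j < n) kappa j.+1)) 0).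

Definition joint_B : 'M[R]_(1 + 1 + (1 + n), n + 1) :=
  col_mx joint_B1 joint_B2.

End Matrices.

(* The output matrix has blocks of size n - 1, so it is stated for
   n = m.+1; the block dimensions 1 + 1 + m and 4 + m are convertible to
   1 + n and 1 + 1 + (1 + n). *)
Definition joint_C (m : nat) : 'M[R]_(1 + m.+1, 1 + 1 + (1 + m.+1)) :=
  block_mx (col_mx (delta_mx 0 0 : 'rV[R]_4) (delta_mx 0 ord_max : 'rV[R]_4))
             (0 : 'M[R]_(1 + 1, m))
           (0 : 'M[R]_(m, 4))
             (1%:M : 'M[R]_m).

Section Signals.
Variables (n : nat) (pl pr ql qr : nat -> R -> R).

Definition joint_u (t : R) : 'cV[R]_(n + 1) :=
  col_mx (\col_(j < n) pl j.+1 t) (qr 0%N t)%:M.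

Definition joint_x (t : R) : 'cV[R]_(1 + 1 + (1 + n)) :=
  col_mx (col_mx (pr 0%N t)%:M (pr 1%N t)%:M) (\col_(j < 1 + n) ql j t).

Definition joint_y (t : R) : 'cV[R]_(1 + n) :=
  col_mx (pr 0%N t)%:M (\col_(j < n) ql j.+1 t).

End Signals.
End JointModel.

(* Main.v *)
Require Import Defs.
From mathcomp Require Import all_boot all_order all_algebra.
From mathcomp Require Import all_classical all_reals all_analysis.
From mathcomp Require Import ring.
Import Order.TTheory GRing.Theory Num.Theory.
Import numFieldNormedType.Exports.
Local Open Scope ring_scope.

(** Apart from [pr 1], every component of the state obeys its own pipe equation, with [pl 0]
    replaced by the common joint pressure [pr 1]. The only difficulty is that the equation for
    [pr 1] contains the outflow [qr 1], which is neither state nor input. Since the incoming pipes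
    share their end pressure, its rate c equals alpha_j (q_{j,r} - q_{j,l}) for every j >= 1.
    Dividing by alpha_j, summing and using the flow balance eliminates all the outflows: c = a
    (q_{0,l} - sum_j q_{j,l}), where a is the inverse of sum_j 1/alpha_j ([joint_aE],
    [joint_pressure_rate]). The rest is block algebra: [joint_rhsE] for the dynamics, [joint_yE] for
    the output. *)

Lemma is_derive_mx (R : realFieldType) (V : normedModType R) (m n : nat)
    (M : V -> 'M[R]_(m, n)) (dM : 'M[R]_(m, n)) (t v : V) :
  (forall i j, is_derive t v (fun x => M x i j) (dM i j)) ->
  is_derive t v M dM.
Proof.
move=> dMij.
have derM : derivable M t v.
  by apply/derivable_mxP => i j; have [] := dMij i j.
apply: DeriveDef => //; rewrite derive_mx //.
by apply/matrixP => i j; rewrite mxE; have [] := dMij i j.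
Qed.

Lemma is_derive_col_mx (R : realFieldType) (V : normedModType R)
    (m1 m2 n : nat) (M1 : V -> 'M[R]_(m1, n)) (M2 : V -> 'M[R]_(m2, n))
    (dM1 : 'M[R]_(m1, n)) (dM2 : 'M[R]_(m2, n)) (t v : V) :
  is_derive t v M1 dM1 -> is_derive t v M2 dM2 ->
  is_derive t v (fun x => col_mx (M1 x) (M2 x)) (col_mx dM1 dM2).
Proof.
have entry k (M : V -> 'M[R]_(k, n)) dM i j :
    is_derive t v M dM -> is_derive t v (fun x => M x i j) (dM i j).
  move=> [derM dME]; apply: DeriveDef; first by move/derivable_mxP: derM.
  by rewrite -dME derive_mx // mxE.
move=> dM1P dM2P; apply: is_derive_mx => i j.
case: (split_ordP i) => k ->.
  rewrite col_mxEu; under eq_fun do rewrite col_mxEu; exact: entry.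
rewrite col_mxEd; under eq_fun do rewrite col_mxEd; exact: entry.
Qed.

Lemma is_derive_scalar_mx1 (R : realFieldType) (V : normedModType R)
    (f : V -> R) (df : R) (t v : V) :
  is_derive t v f df ->
  is_derive t v (fun x => (f x)%:M : 'M[R]_1) df%:M.
Proof.
move=> dfP; apply: is_derive_mx => i j; rewrite !ord1 mxE mulr1n.
by under eq_fun do rewrite mxE mulr1n.
Qed.

Lemma sum_prod_others (F : fieldType) (I : eqType) (s : seq I) (a : I -> F) :
  uniq s -> {in s, forall i, a i != 0} ->
  \sum_(j <- s) \prod_(i <- s | i != j) a i
    = (\prod_(i <- s) a i) * \sum_(j <- s) (a j)^-1.
Proof.
move=> s_uniq a_neq0; rewrite mulr_sumr; apply: eq_big_seq => j sj.
rewrite [in RHS](bigD1_seq j) //=.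
by rewrite mulrAC divff ?mul1r // a_neq0.
Qed.

(** The numerator of a is the product of all alpha_j, and the same product factors out of the sum in
    the denominator, so it cancels. *)
Lemma joint_aE (R : realType) (n : nat) (alpha : nat -> R) :
  (0 < n)%N -> (forall j, (1 <= j <= n)%N -> alpha j != 0) ->
  joint_a n alpha = (\sum_(1 <= j < n.+1) (alpha j)^-1)^-1.
Proof.
move=> n_gt0 alpha_neq0; rewrite /joint_a.
have alpha_iota j : j \in index_iota 1 n.+1 -> alpha j != 0.
  by rewrite mem_index_iota => /alpha_neq0.
rewrite mulrAC -big_ltn // sum_prod_others ?iota_uniq //.
rewrite invfM mulrA divff ?mul1r // prodf_seq_neq0.
by apply/allP => j /alpha_iota ->.
Qed.

(* On an open set of times the pipe end pressures coincide, so their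
   derivatives do too; dividing by [alpha j] and summing gives the flow balance
   at the joint. *)
Lemma joint_pressure_rate (R : realType) (n : nat) (alpha : nat -> R)
    (D : set R) (p : R -> R) (pr ql qr : nat -> R -> R) (t : R) :
  (0 < n)%N -> (forall j, (1 <= j <= n)%N -> alpha j < 0) ->
  open D -> D t ->
  (forall j s, (1 <= j <= n)%N -> D s -> pr j s = p s) ->
  (forall j, (1 <= j <= n)%N ->
     is_derive t 1 (pr j) (alpha j * (qr j t - ql j t))) ->
  alpha 1%N * (qr 1%N t - ql 1%N t)
    = joint_a n alpha * (\sum_(1 <= j < n.+1) qr j t
                         - \sum_(1 <= j < n.+1) ql j t).
Proof.
move=> n_gt0 alpha_lt0 D_open Dt prE dpr.
set c := LHS.
have rateE j : (1 <= j <= n)%N -> alpha j * (qr j t - ql j t) = c.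
  move=> jn; rewrite /c; have [_ <-] := dpr j jn; have [_ <-] := dpr 1%N n_gt0.
  (* Equality at [t] alone would say nothing about derivatives; [D] being open gives it on a
     neighbourhood. *)
  apply: near_eq_derive; have : nbhs t D by apply: open_nbhs_nbhs.
  by apply: filterS => s Ds; rewrite !prE.
rewrite joint_aE // => [|j /alpha_lt0/ltr0_neq0//].
have -> : \sum_(1 <= j < n.+1) qr j t - \sum_(1 <= j < n.+1) ql j t
    = (\sum_(1 <= j < n.+1) (alpha j)^-1) * c.
  rewrite -sumrB mulr_suml; apply: eq_big_nat => j jn.
  by rewrite -(rateE j jn) mulKf // ltr0_neq0 // alpha_lt0.
(* All the alpha_j have the same sign, so the sum of their inverses is negative and cannot
   vanish. *)
rewrite mulKf // ltr0_neq0 // big_ltn // ltr_wnDr //.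
  rewrite big_nat; apply: sumr_le0 => j /andP[j_gt1 jn].
  by rewrite invr_le0 ltW // alpha_lt0 // (ltnW j_gt1).
by rewrite invr_lt0 alpha_lt0.
Qed.

Lemma joint_rhsE (R : realType) (n : nat) (alpha beta kappa gamma : nat -> R)
    (pl pr ql qr : nat -> R -> R) (t : R) :
  joint_A n alpha beta kappa gamma *m joint_x n pr ql t
    + joint_B n alpha kappa *m joint_u n pl qr t
  = col_mx
      (col_mx (alpha 0%N * (qr 0%N t - ql 0%N t))%:M
              (joint_a n alpha * (ql 0%N t - \sum_(j < n) ql j.+1 t))%:M)
      (col_mx (beta 0%N * pr 0%N t + kappa 0%N * pr 1%N t
                 + gamma 0%N * ql 0%N t)%:M
              (\col_(j < n) (beta j.+1 * pr 1%N t + kappa j.+1 * pl j.+1 t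
                 + gamma j.+1 * ql j.+1 t))).
Proof.
(* Splitting pipe 0 off the flows, and off [joint_A22] below, lets all products be taken block by
   block. *)
have qlE : \col_(j < 1 + n) ql j t
    = col_mx (ql 0%N t)%:M (\col_(j < n) ql j.+1 t).
  apply/colP => i; rewrite mxE; case: (split_ordP i) => k ->.
    by rewrite col_mxEu ord1 mxE mulr1n.
  by rewrite col_mxEd mxE.
have gammaE : joint_A22 n gamma = block_mx (gamma 0%N)%:M 0
    0 (diag_mx (\row_(j < n) gamma j.+1)).
  rewrite /joint_A22 -[X in block_mx X]diag_const_mx -diag_mx_row.
  congr diag_mx; apply/rowP => i; rewrite mxE; case: (split_ordP i) => k ->.
    by rewrite row_mxEl ord1 mxE.
  by rewrite row_mxEr mxE.
rewrite /joint_A /joint_x /joint_B /joint_u /joint_B1 /joint_B2 qlE gammaE.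
rewrite /joint_A12 /joint_A21 tr_block_mx.
rewrite !mul_block_col mul_col_mx !mul_block_col.
rewrite mul_col_mx mul_row_col !mul0mx !add0r !addr0 !add_col_mx ?add0r ?addr0.
rewrite !tr_scalar_mx !mul_scalar_mx trmx0 mul0mx ?add0r.
congr (col_mx (col_mx _ _) (col_mx _ _));
  apply/colP => i; rewrite ?(ord1 i).
- by rewrite !mxE !mulr1n; ring.
- rewrite -scalemxAl !mxE !mulr1n mulrBr mulNr; congr (_ - _ * _).
  by apply: eq_bigr => j _; rewrite !mxE mul1r.
- by rewrite !mxE !mulr1n; ring.
- by rewrite mul_mx_scalar !mul_diag_mx !mxE; ring.
Qed.

(** Each output is one state entry: row 0 picks p_{0,r}, and row i > 0 picks q_{i,l}, which sits at
    i + 2 because p_{1,r} and q_{0,l} are skipped. *)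
Lemma joint_CE (R : realType) (m : nat) (i : 'I_(1 + m.+1))
    (k : 'I_(1 + 1 + (1 + m.+1))) :
  joint_C R m i k = (k == (if i == 0 :> nat then 0 else i.+2) :> nat)%:R.
Proof.
(* The block view of [joint_C] has dimensions only convertible to the stated ones. *)
rewrite -[LHS]/(@fun_of_matrix R (1 + 1 + m) (4 + m) (joint_C R m) i k).
rewrite /joint_C.
case: (split_ordP (i : 'I_(1 + 1 + m))) => i' ->;
  case: (split_ordP (k : 'I_(4 + m))) => k' ->.
- rewrite block_mxEul; case: (split_ordP i') => l ->; rewrite ord1.
    by rewrite col_mxEu mxE.
  by rewrite col_mxEd mxE.
- by rewrite block_mxEur mxE; case: (split_ordP i') => l -> /=; rewrite ord1.
(* Rows of the lower blocks select a column of index at least 4, outside this block. *)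
- rewrite block_mxEdl mxE /=; case: eqP => // kE.
  by have := ltn_ord k'; rewrite kE.
- by rewrite block_mxEdr mxE /= !add2n !eqSS eq_sym.
Qed.

Lemma joint_yE (R : realType) (m : nat) (pr ql : nat -> R -> R) (t : R) :
  joint_y m.+1 pr ql t = joint_C R m *m joint_x m.+1 pr ql t.
Proof.
apply/colP => i; rewrite [RHS]mxE.
under eq_bigr => k _ do rewrite joint_CE.
case: (split_ordP i) => j ->.
  rewrite (bigD1 (lshift (1 + m.+1) (lshift 1 (0 : 'I_1)))) //= big1.
    by rewrite /joint_x !col_mxEu ord1 !mxE mul1r addr0.
  by move=> k; rewrite ord1 -val_eqE /= => /negbTE ->; rewrite mul0r.
rewrite (bigD1 (rshift (1 + 1) (rshift 1 j))) //= big1 => [|k].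
  by rewrite /joint_x !col_mxEd !mxE eqxx mul1r addr0.
by rewrite -val_eqE /= => /negbTE ->; rewrite mul0r.
Qed.

(* n = m.+1 >= 1 pipes merge into pipe 0; D is the set of times considered. *)
Theorem mainTheorem3 (R : realType) (m : nat)
  (Rs T0 z0 : R) (area len alpha beta kappa gamma : nat -> R)
  (D : set R) (pl pr ql qr : nat -> R -> R)
  (Rs_gt0 : 0 < Rs) (T0_gt0 : 0 < T0) (z0_gt0 : 0 < z0)
  (area_gt0 : forall j, (j <= m.+1)%N -> 0 < area j)
  (len_gt0 : forall j, (j <= m.+1)%N -> 0 < len j)
  (alphaE : forall j, (j <= m.+1)%N ->
     alpha j = - (Rs * T0 * z0 / (area j * len j)))
  (betaE : forall j, (j <= m.+1)%N -> beta j = - (area j / len j))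
  (D_open : open D)
  (dpr : forall j t, (j <= m.+1)%N -> D t ->
     is_derive t 1 (pr j) (alpha j * (qr j t - ql j t)))
  (dql : forall j t, (j <= m.+1)%N -> D t ->
     is_derive t 1 (ql j)
       (beta j * pr j t + kappa j * pl j t + gamma j * ql j t))
  (match_p : forall j t, (1 <= j <= m.+1)%N -> D t -> pr j t = pl 0%N t)
  (match_q : forall t, D t -> \sum_(1 <= j < m.+2) qr j t = ql 0%N t) :
  forall t, D t ->
    is_derive t 1 (joint_x m.+1 pr ql)
      (joint_A m.+1 alpha beta kappa gamma *m joint_x m.+1 pr ql t
       + joint_B m.+1 alpha kappa *m joint_u m.+1 pl qr t)
    /\ joint_y m.+1 pr ql t = joint_C R m *m joint_x m.+1 pr ql t.
Proof.
move=> t Dt; split; last exact: joint_yE.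
have alpha_lt0 j : (1 <= j <= m.+1)%N -> alpha j < 0.
  move=> /andP[_ jn]; rewrite alphaE // oppr_lt0.
  by rewrite divr_gt0 ?mulr_gt0 ?area_gt0 ?len_gt0.
have match_p1 j : (1 <= j <= m.+1)%N -> pr j t = pl 0%N t.
  by move=> jn; exact: match_p.
have rate1 := @joint_pressure_rate R m.+1 alpha D (pl 0%N) pr ql qr t
  (ltn0Sn _) alpha_lt0 D_open Dt match_p
  (fun j (jn : (1 <= j <= m.+1)%N) => dpr j t (proj2 (andP jn)) Dt).
rewrite joint_rhsE; apply: is_derive_col_mx.
  apply: is_derive_col_mx; apply: is_derive_scalar_mx1; first exact: dpr.
  (* Reading q_{0,l} as the total inflow turns this entry into the right-hand side of [rate1]. *)
  rewrite -(match_q t Dt).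
  have <- : \sum_(1 <= j < m.+2) ql j t = \sum_(j < m.+1) ql j.+1 t.
    by rewrite big_add1 big_mkord.
  by rewrite -rate1; exact: dpr.
apply: is_derive_mx => i j; rewrite ord1.
under eq_fun do rewrite mxE.
case: (split_ordP i) => k ->.
  by rewrite ord1 col_mxEu mxE mulr1n (match_p1 1%N) //; exact: dql.
have kn : (k.+1 <= m.+1)%N by exact: ltn_ord.
(* The state holds only [pr 1]; it is exchanged for [pr k.+1] through the joint pressure [pl 0]. *)
by rewrite col_mxEd mxE (match_p1 1%N) // -(match_p1 k.+1) //; exact: dql.
Qed.
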